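(* Let $L$ be a continuous dcpo. Then $\widetilde{\mathcal{U}L}=\{\mathcal{F}_K: K\in\mathcal{Q}(L)\}$, and the map $K\mapsto\mathcal{F}_K$ is an order isomorphism from $\mathcal{Q}(L)$ (ordered by reverse inclusion) onto $\widetilde{\mathcal{U}L}$ (ordered by inclusion).
   Context: $\mathcal{Q}(L)$ is the set of nonempty Scott-compact saturated subsets of $L$. For $K\in\mathcal{Q}(L)$, $\mathcal{F}_K=\{{\uparrow}F: F \text{ nonempty finite}\subseteq L,\ K\subseteq{\uparrow}F\}$. $\mathcal{U}L=(UL,O_{\Rightarrow_U}(UL))$ where $UL=\{{\uparrow}F: F \text{ nonempty finite} \subseteq L\}$ ordered by ${\uparrow}F_1\leq_U{\uparrow}F_2$ iff ${\uparrow}F_2\subseteq{\uparrow}F_1$; for a directed $D\subseteq L$, $\lim D$ is the set of points to which $D$ converges in $\Sigma L$; for $\leq_U$-directed $\mathcal{F}\subseteq UL$, $\mathcal{F}\Rightarrow_U{\uparrow}F$ iff there are finitely many directed $D_1,\dots,D_n\subseteq L$ with (1) $F\cap\lim D_i\neq\emptyset$ for all $i$, (2) $F\subseteq\bigcup_i\lim D_i$, (3) for all $(d_1,\dots,d_n)\in\prod_iD_i$ some ${\uparrow}F'\in\mathcal{F}$ satisfies ${\uparrow}F'\subseteq\bigcup_i{\uparrow}d_i$; and $\mathcal{V}\subseteq UL$ is open iff $\mathcal{F}\Rightarrow_U{\uparrow}F\in\mathcal{V}$ implies $\mathcal{F}\cap\mathcal{V}\neq\emptyset$. For a space $X$, $\widetilde{X}$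 is the smallest subset of the dcpo $\Gamma(X)$ of nonempty closed subsets (ordered by inclusion) that contains all principal lower sets ${\downarrow}x$ ($x\in X$, in the specialization order) and is closed under suprema of directed subsets existing in $\Gamma(X)$. *)

(* Defs.v *)
From HB Require Import structures.
From mathcomp Require Import all_boot all_order.
From mathcomp Require Import all_classical.
From mathcomp Require Import topology.

Set Implicit Arguments.
Unset Strict Implicit.
Unset Printing Implicit Defensive.

Import Order.TTheory.
Local Open Scope classical_set_scope.

Definition directed {T : Type} (R : T -> T -> Prop) (D : set T) : Prop :=
  D !=set0 /\
  forall x y, D x -> D y -> exists z, [/\ D z, R x z & R y z].

Section Domain.
Context {d : Order.disp_t} {L : porderType d}.
Implicit Types (x y : L) (A D : set L).

Definition order_directed D : Prop := directed (fun x y => (x <= y)%O) D.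

Definition up_closure A : set L := [set y | exists2 x, A x & (x <= y)%O].

Definition way_below x y : Prop :=
  forall D s, order_directed D -> supremums D s -> (y <= s)%O ->
    exists2 e, D e & (x <= e)%O.

Definition scott_open A : Prop :=
  (forall x y, A x -> (x <= y)%O -> A y) /\
  (forall D s, order_directed D -> supremums D s -> A s -> D `&` A !=set0).

End Domain.

Definition dcpo {d : Order.disp_t} (L : porderType d) : Prop :=
  forall D : set L, order_directed D -> exists s, supremums D s.

Definition continuous_dcpo {d : Order.disp_t} (L : porderType d) : Prop :=
  dcpo L /\
  forall x : L, order_directed [set y | way_below y x] /\
                supremums [set y | way_below y x] x.

(* A copy of L, carrying the Scott topology. *)
Definition scott {d : Order.disp_t} (L : porderType d) : Type := L.

Section ScottTopology.
Context {d : Order.disp_t} (L : porderType d).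

Lemma scott_openT : scott_open [set: L].
Proof. by split=> // D s [[x Dx] _] _ _; exists x. Qed.

Lemma scott_openI : setI_closed (@scott_open d L).
Proof.
move=> A B [uA oA] [uB oB]; split=> [x y [Ax Bx] xy|D s dD sD [As Bs]].
  by split; [exact: uA Ax xy|exact: uB Bx xy].
have [x [Dx Ax]] := oA _ _ dD sD As.
have [y [Dy By]] := oB _ _ dD sD Bs.
have [z [Dz xz yz]] := dD.2 _ _ Dx Dy.
by exists z; split=> //; split; [exact: uA Ax xz|exact: uB By yz].
Qed.

Lemma scott_open_bigU (I : Type) (f : I -> set L) :
  (forall i, scott_open (f i)) -> scott_open (\bigcup_i f i).
Proof.
move=> fo; split=> [x y [i _ fx] xy|D s dD sD [i _ fs]].
  by exists i => //; exact: (fo i).1 fx xy.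
by have [x [Dx fx]] := (fo i).2 _ _ dD sD fs; exists x; split=> //; exists i.
Qed.

HB.instance Definition _ := Choice.on (scott L).
HB.instance Definition _ := isOpenTopological.Build (scott L)
  scott_openT scott_openI scott_open_bigU.

End ScottTopology.

(* D is regarded as a net indexed by itself; the filter is that of its tails. *)
Definition scott_lim {d : Order.disp_t} {L : porderType d} (D : set L) :
    set (scott L) :=
  [set x | filter_from D (fun e => D `&` [set y | (e <= y)%O])
             --> (x : scott L)].

Lemma scott_limP {d : Order.disp_t} {L : porderType d} (D : set L) (x : L) :
  order_directed D ->
  scott_lim D x <-> forall U, scott_open U -> U x -> D `&` U !=set0.
Proof.
move=> dD; split=> [Dx U oU Ux|H A].
  have [e De sU] : filter_from D (fun e => D `&` [set y | (e <= y)%O]) U.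
    by apply: (Dx U); apply: (@open_nbhs_nbhs (scott L)); split.
  by exists e; split=> //; apply: sU; split=> /=.
rewrite nbhsE => -[U [oU Ux] UA].
have [e [De Ue]] := H U oU Ux.
by exists e => // y [_ ey]; apply: UA; exact: oU.1 Ue ey.
Qed.

Definition saturated {X : topologicalType} (A : set X) : Prop :=
  A = \bigcap_(U in [set U | open U /\ A `<=` U]) U.

Definition Qsets {d : Order.disp_t} (L : porderType d) : set (set (scott L)) :=
  [set K | [/\ K !=set0, compact K & saturated K]].

Arguments Qsets {d} L.

Record fin_upset {d : Order.disp_t} (L : porderType d) : Type := FinUpset {
  upset_of :> set L ;
  fin_upsetP : exists F : set L,
    [/\ finite_set F, F !=set0 & upset_of = up_closure F] }.

HB.instance Definition _ {d : Order.disp_t} (L : porderType d) :=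
  gen_eqMixin (fin_upset L).
HB.instance Definition _ {d : Order.disp_t} (L : porderType d) :=
  gen_choiceMixin (fin_upset L).

Section UpperTopology.
Context {d : Order.disp_t} (L : porderType d).
Implicit Types (FF : set (fin_upset L)) (V W : fin_upset L) (F : set L).

Definition leU V W : Prop := (W : set L) `<=` V.

Definition cvgU_gen FF F : Prop :=
  exists (n : nat) (D : 'I_n -> set L),
    [/\ forall i, order_directed (D i),
        forall i, F `&` scott_lim (D i) !=set0,
        F `<=` \bigcup_i scott_lim (D i)
      & forall e : 'I_n -> L, (forall i, D i (e i)) ->
          exists2 W, FF W & (W : set L) `<=` \bigcup_i up_closure [set e i]].

(* The generating set of V is not unique, but the choice of F does not matter:
   see cvgU_genP. *)
Definition cvgU FF V : Prop :=
  exists F, [/\ finite_set F, F !=set0, (V : set L) = up_closure F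
              & cvgU_gen FF F].

Lemma scott_lim_le (D : set L) x y :
  order_directed D -> scott_lim D y -> (x <= y)%O -> scott_lim D x.
Proof.
move=> dD /(scott_limP _ dD) Dy xy; apply/(scott_limP _ dD) => U oU Ux.
by apply: Dy => //; exact: oU.1 Ux xy.
Qed.

Lemma order_directed1 (x : L) : order_directed [set x].
Proof. by split; [exists x|move=> _ _ -> ->; exists x]. Qed.

Lemma scott_lim1 (x : L) : scott_lim [set x] x.
Proof.
by apply/(scott_limP _ (order_directed1 x)) => U _ Ux; exists x.
Qed.

Lemma cvgU_gen1 FF F : finite_set F ->
  (exists2 W, FF W & (W : set L) `<=` up_closure F) -> cvgU_gen FF F.
Proof.
move=> /finite_seqP[s ->] [W FFW WF].
exists (size s), (fun i => [set tnth (in_tuple s) i]); split.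
- by move=> i; exact: order_directed1.
- move=> i; exists (tnth (in_tuple s) i); split; last exact: scott_lim1.
  by rewrite /= mem_tnth.
- move=> x /= /(tnthP (in_tuple s))[i ->]; exists i => //; exact: scott_lim1.
- move=> e De; exists W => // y /WF[x /= /(tnthP (in_tuple s))[i ->] xy].
  by exists i => //; exists (e i) => //; rewrite De.
Qed.

Lemma cvgU_genP FF F G : finite_set G -> up_closure F = up_closure G ->
  cvgU_gen FF F -> cvgU_gen FF G.
Proof.
move=> /finite_seqP[s GE] FG [n [D [dD D1 D2 D3]]].
pose t := in_tuple s.
exists (n + size s)%N, (fun i => match fintype.split i with
  | inl j => D j | inr k => [set tnth t k] end); split.
- by move=> i; case: fintype.split => k //; exact: order_directed1.
- move=> i; case: fintype.split => k; last first.
    by exists (tnth t k); split; [rewrite GE /= mem_tnth|exact: scott_lim1].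
  have [f [Ff Df]] := D1 k.
  have [g Gg gf] : up_closure G f by rewrite -FG; exists f.
  by exists g; split=> //; exact: scott_lim_le Df gf.
- move=> x; rewrite GE /= => /(tnthP t)[k ->]; exists (rshift n k) => //=.
  by rewrite (unsplitK (inr k)); exact: scott_lim1.
- move=> e De; have [i|W FFW We] := D3 (fun i => e (lshift (size s) i)).
    by have := De (lshift (size s) i); rewrite (unsplitK (inl i)).
  by exists W => // y /We[i _ ei]; exists (lshift (size s) i).
Qed.

Definition upper_open (VV : set (fin_upset L)) : Prop :=
  forall FF V, directed leU FF -> cvgU FF V -> VV V -> FF `&` VV !=set0.

Lemma upper_open_up VV V W : upper_open VV -> VV V -> leU V W -> VV W.
Proof.
move=> oVV VVV VW.
have [|||W' [-> //]] := oVV [set W] V => //.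
  by split; [exists W|move=> _ _ -> ->; exists W; split=> //; exact: subset_refl].
have [F [finF F0 VF]] := fin_upsetP V.
exists F; split=> //; apply: cvgU_gen1 => //; exists W => //.
by rewrite -VF.
Qed.

Lemma upper_openT : upper_open setT.
Proof. by move=> FF V [[W FFW] _] _ _; exists W. Qed.

Lemma upper_openI : setI_closed upper_open.
Proof.
move=> A B oA oB FF V dFF cFF [AV BV].
have [W1 [FW1 AW1]] := oA _ _ dFF cFF AV.
have [W2 [FW2 BW2]] := oB _ _ dFF cFF BV.
have [W [FW le1 le2]] := dFF.2 _ _ FW1 FW2.
exists W; split=> //; split; [exact: upper_open_up AW1 le1|exact: upper_open_up BW2 le2].
Qed.

Lemma upper_open_bigU (I : Type) (f : I -> set (fin_upset L)) :
  (forall i, upper_open (f i)) -> upper_open (\bigcup_i f i).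
Proof.
move=> fo FF V dFF cFF [i _ fV].
by have [W [FW fW]] := fo i _ _ dFF cFF fV; exists W; split=> //; exists i.
Qed.

HB.instance Definition _ := isOpenTopological.Build (fin_upset L)
  upper_openT upper_openI upper_open_bigU.

End UpperTopology.

Arguments leU {d L} V W.
Arguments upper_open {d L} VV.

Definition FK {d : Order.disp_t} {L : porderType d} (K : set (scott L)) :
    set (fin_upset L) :=
  [set V | K `<=` (V : set L)].

Section DirectedCompletion.
Context (X : topologicalType).
Implicit Types (A : set X) (S DD : set (set X)).

Definition specialization_le (x y : X) : Prop := closure [set y] x.

Definition principal_lower (x : X) : set X := [set y | specialization_le y x].

Definition Gamma : set (set X) := [set A | closed A /\ A !=set0].

Definition Gamma_sup DD A : Prop :=
  [/\ Gamma A, forall B, DD B -> B `<=` A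
    & forall C, Gamma C -> (forall B, DD B -> B `<=` C) -> A `<=` C].

Definition Gamma_sup_closed S : Prop :=
  S `<=` Gamma /\
  forall DD A, DD `<=` S -> directed subset DD -> Gamma_sup DD A -> S A.

Definition tilde : set (set X) :=
  smallest Gamma_sup_closed (range principal_lower).

End DirectedCompletion.

Arguments specialization_le {X} x y.
Arguments principal_lower {X} x.
Arguments Gamma X : clear implicits.
Arguments tilde X : clear implicits.

(* Main.v *)
Require Import Defs.
From HB Require Import structures.
From mathcomp Require Import all_boot all_order.
From mathcomp Require Import all_classical.
From mathcomp Require Import finmap topology.

(**
  The family [F_K] need not be directed, but its subfamily [FK_int K] of those
  finitely generated upper sets that contain a Scott-open neighbourhood of [K]
  is: compactness of [K] and continuity of [L] interpolate a finitely generated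
  upper set between [K] and any of its open neighbourhoods. Its intersection is
  [K], and [FK_int V] converges to [V] for every [V] in [UL], so that a closed
  subset of [UL] containing [FK_int V] contains [V]. Hence [F_K] is the directed
  supremum of the principal lower sets of the members of [FK_int K]. Conversely,
  Rudin's lemma makes the Scott topology of a continuous dcpo well-filtered, and
  then the supremum of a directed family of sets [F_K] is the set [F_K']
  attached to the intersection [K'] of the sets [K].
*)

Set Implicit Arguments.
Unset Strict Implicit.
Unset Printing Implicit Defensive.

Import Order.TTheory.
Local Open Scope classical_set_scope.

(** The point of [A] turns [T] into a pointed space, to which [compact_cover] applies. *)
Lemma compact_coverP (T : topologicalType) (A : set T) :
  A !=set0 -> compact A <-> cover_compact A.
Proof.
move=> [x _].
pose pT : ptopologicalType := HB.pack (Topological.sort T) (Topological.class T)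
  (isPointed.Build T x).
by rewrite -[compact A]/(@compact pT A) (@compact_cover pT).
Qed.

(** * Scott limits, saturation and finitely generated upper sets *)

Section ScottTopologyTheory.
Context {d : Order.disp_t} {L : porderType d}.
Implicit Types (x y z : L) (D : set L) (U : set L) (K : set (scott L)).

Lemma not_le_scott_open (s : L) : scott_open [set y | ~ (y <= s)%O].
Proof.
split=> [y z ys yz zs|E t dE tE ts]; first by apply: ys; exact: le_trans yz zs.
apply: contrapT => E0; apply: ts; apply: tE.2 => y Ey.
by apply: contrapT => ys; apply: E0; exists y.
Qed.

(** The complement of the lower set of [s] is Scott open and misses [D], so it contains no limit of
    [D]. *)
Lemma scott_lim_le_sup D s x :
  order_directed D -> supremums D s -> scott_lim D x <-> (x <= s)%O.
Proof.
move=> dD sD; split=> [/(scott_limP _ dD) Dx|xs]; last first.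
  apply/(scott_limP _ dD) => U oU Ux.
  exact: oU.2 _ _ dD sD (oU.1 _ _ Ux xs).
apply: contrapT => xs; have [e [De]] := Dx _ (not_le_scott_open s) xs.
by apply; exact: sD.1 _ De.
Qed.

Lemma saturated_scottP K :
  saturated K <-> (forall x y, K x -> (x <= y)%O -> K y).
Proof.
split=> [Ksat x y Kx xy|Kup].
  by rewrite Ksat => U [[Uup _] KU]; exact: Uup (KU _ Kx) xy.
apply/seteqP; split=> [x Kx U [_]|x Kx]; first exact.
apply: contrapT => nKx.
apply: (Kx [set y : scott L | ~ ((y : L) <= (x : L))%O]); last exact: lexx.
by split; [exact: not_le_scott_open|move=> y Ky yx; apply: nKx; exact: Kup Ky yx].
Qed.

Lemma fin_upset_up (V : fin_upset L) x y :
  (V : set L) x -> (x <= y)%O -> (V : set L) y.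
Proof.
have [F [_ _ ->]] := fin_upsetP V.
by move=> [z Fz zx] xy; exists z => //; exact: le_trans zx xy.
Qed.

(** Scott-open sets are upper sets, so a finite subcover of the generators covers all of [V]. *)
Lemma fin_upset_Qsets (V : fin_upset L) : Qsets L V.
Proof.
have [F [finF [x Fx] VF]] := fin_upsetP V.
have FV : F `<=` V by rewrite VF => y Fy; exists y.
have V0 : (V : set L) !=set0 by exists x; exact: FV.
split=> //.
- have /compact_coverP Fco := @finite_compact (scott L) F finF.
  apply/compact_coverP => // I D f fo Vf.
  have [D' D'D FD'] := Fco (ex_intro _ x Fx) I D f fo (subset_trans FV Vf).
  exists D' => // y; rewrite VF => -[z /FD'[i D'i fz] zy].
  by exists i => //; apply: (fo i _).1 fz zy; exact/set_mem/D'D.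
- by apply/saturated_scottP; exact: fin_upset_up.
Qed.

End ScottTopologyTheory.

(** * Rudin's lemma for finitely generated upper sets *)

Section Rudin.
Context {d : Order.disp_t} {L : porderType d}.
Implicit Types (FF : set (fin_upset L)) (U : set L).

(** Finitely many points involve finitely many members of the chain, and the largest of these serves
    for all. This gives the chain condition of Zorn's lemma in [rudin]. *)
Lemma finite_sub_chain (CC : set (set L)) U (F : set L) :
  finite_set F -> total_on CC subset -> CC !=set0 ->
  F `<=` (\bigcup_(A in CC) A) `|` U -> exists2 A, CC A & F `<=` A `|` U.
Proof.
move=> /finite_seqP[s ->] CCtot [A0 CCA0].
elim: s => [|x s IH] sCC; first by exists A0.
have [A CCA sA] : exists2 A, CC A & [set` s] `<=` A `|` U.
  by apply: IH => y ys; apply: sCC; rewrite /= inE ys orbT.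
have [|[B CCB Bx]|Ux] := sCC x; first by rewrite /= mem_head.
- have [AB|BA] := CCtot _ _ CCA CCB.
  + exists B => // y; rewrite /= inE => /predU1P[->|ys]; first by left.
    by have [/AB|] := sA _ ys; [left|right].
  + exists A => // y; rewrite /= inE => /predU1P[->|ys]; last exact: sA.
    by left; exact: BA.
- exists A => // y; rewrite /= inE => /predU1P[->|ys]; last exact: sA.
  by right.
Qed.

(* If no member of FF lies in U, take an upper set A maximal among those for
   which no member of FF lies in A `|` U; maximality makes the complement of
   A `|` U directed, and its supremum lies in every member of FF but not in U. *)
Lemma rudin FF U : dcpo L -> directed leU FF -> scott_open U ->
  \bigcap_(W in FF) (W : set L) `<=` U ->
  exists2 W, FF W & (W : set L) `<=` U.
Proof.
move=> dcL [[W0 FW0] dFF] oU FFU; apply: contrapT => noW.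
pose P := [set A : set L | (forall x y, A x -> (x <= y)%O -> A y) /\
  forall W, FF W -> ~ ((W : set L) `<=` A `|` U)].
have [CC CCP CCtot|A [[Aup AFF] Amax]] := @Zorn_bigcup L P.
  split=> [x y [A CCA Ax] xy|W FFW WCC].
    by exists A => //; exact: (CCP _ CCA).1 Ax xy.
  (* The empty chain has empty union, for which the condition is [noW]. *)
  have [CC0|/set0P/negP] := pselect (CC !=set0); last first.
    rewrite negbK => /eqP CC0; apply: noW; exists W => //.
    by move: WCC; rewrite CC0 bigcup_set0 set0U.
  have [F [finF _ WF]] := fin_upsetP W.
  have FW : F `<=` W by rewrite WF => y Fy; exists y.
  have [A CCA FA] := finite_sub_chain finF CCtot CC0 (subset_trans FW WCC).
  apply: ((CCP _ CCA).2 W FFW); rewrite WF => y [x /FA[Ax|Ux] xy].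
    by left; exact: (CCP _ CCA).1 Ax xy.
  by right; exact: oU.1 Ux xy.
pose M := ~` (A `|` U).
have MW W : FF W -> exists2 z, (W : set L) z & M z.
  move=> FFW; apply: contrapT => nz; apply: (AFF W FFW) => z Wz.
  by apply: contrapT => Mz; apply: nz; exists z.
have Mx x : M x -> exists2 W : fin_upset L, FF W &
    forall z, (W : set L) z -> M z -> (x <= z)%O.
  move=> Mx; apply: contrapT => nW.
  (* As [x] is not in [A], adjoining its principal upper set must break the condition; a [W] inside
     the enlarged union meets [M] only above [x]. *)
  apply: (Amax (A `|` [set z | (x <= z)%O])).
    split; first by left.
    by move=> BA; apply: Mx; left; apply: BA; right => /=.
  split=> [y z [Ay|/= xy] yz|W FFW WA].
  - by left; exact: Aup Ay yz.
  - by right; exact: le_trans xy yz.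
  - apply: nW; exists W => // z Wz Mz.
    by have [[Az|//]|Uz] := WA _ Wz; case: Mz; [left|right].
have dM : order_directed M.
  split=> [|x y /Mx[W1 FW1 W1x] /Mx[W2 FW2 W2y]].
    by have [z _ Mz] := MW _ FW0; exists z.
  have [W [FW le1 le2]] := dFF _ _ FW1 FW2.
  have [z Wz Mz] := MW _ FW; exists z; split=> //.
    by apply: W1x => //; exact: le1.
  by apply: W2y => //; exact: le2.
have [s sM] := dcL _ dM.
have Us : U s.
  apply: FFU => W /MW[z Wz Mz]; apply: fin_upset_up Wz _.
  exact: sM.1 _ Mz.
by have [z [Mz Uz]] := oU.2 _ _ dM sM Us; apply: Mz; right.
Qed.

End Rudin.

(** * Closed sets and specialization order of the upper space *)

Section UpperSpace.
Context {d : Order.disp_t} {L : porderType d}.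
Implicit Types (CC : set (fin_upset L)) (K : set (scott L)) (V W : fin_upset L).

Lemma closed_cvgU CC FF V : closed CC -> directed leU FF -> FF `<=` CC ->
  cvgU FF V -> CC V.
Proof.
move=> /closed_openC oC dFF FFC FFV; apply: contrapT => nCV.
by have [W [/FFC CW]] := (oC : upper_open _) _ _ dFF FFV nCV.
Qed.

Lemma FK_closed K : dcpo L -> closed (FK K).
Proof.
move=> dcL; rewrite -openC; change (upper_open (~` FK K)).
move=> FF V dFF [F [_ _ VF [n [D [dD FD _ FFD]]]]] nKV.
apply: contrapT => FF0; apply: nKV => x Kx.
have KW W : FF W -> (W : set L) x.
  move=> FFW; apply: contrapT => nWx; apply: FF0; exists W; split=> // KW.
  by apply: nWx; exact: KW.
have /choice[s sD] : forall i, exists s, supremums (D i) s by move=> i; exact: dcL.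
have [[i sx]|nsx] := pselect (exists i, (s i <= (x : L))%O).
  have [f [Ff /(scott_lim_le_sup _ (dD i) (sD i)) fs]] := FD i.
  by rewrite VF; exists f => //; exact: le_trans fs sx.
(* Otherwise [x] bounds some [D i] and hence its supremum. The chosen [e i] yield a [W] in [FF] that
   omits [x], against [KW]. *)
have /choice[e eD] : forall i, exists e, D i e /\ ~ (e <= (x : L))%O.
  move=> i; apply: contrapT => ne; apply: nsx; exists i.
  apply: (sD i).2 => e De; apply: contrapT => ex.
  by apply: ne; exists e.
have [|W FFW] := FFD e; first by move=> i; exact: (eD i).1.
by move=> /(_ _ (KW _ FFW))[i _ [_ /= -> ex]]; case: (eD i).
Qed.

Lemma principal_lowerE V : dcpo L -> principal_lower V = FK (V : set L).
Proof.
move=> dcL; apply/seteqP; split=> W; rewrite /principal_lower/= /specialization_le.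
  rewrite closureE; apply; split; first exact: FK_closed.
  by move=> _ ->.
move=> VW A; rewrite nbhsE => -[O [oO OW] OA].
by exists V; split=> //; apply: OA; exact: upper_open_up oO OW VW.
Qed.

Definition FK_int K : set (fin_upset L) :=
  [set V | exists2 U : set L, scott_open U & K `<=` U /\ U `<=` V].

Lemma FK_int_sub K1 K2 : K1 `<=` K2 -> FK_int K2 `<=` FK_int K1.
Proof. by move=> K12 V [U oU [KU UV]]; exists U => //; split=> // x /K12/KU. Qed.

End UpperSpace.

(** * Consequences of continuity: interpolation, well-filteredness and the completion *)

Section ContinuousDcpo.
Context {d : Order.disp_t} {L : porderType d} (contL : continuous_dcpo L).
Implicit Types (x y z : L) (U : set L) (K : set (scott L)) (V W : fin_upset L).

Let dcL : dcpo L := contL.1.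
Let dir_below x : order_directed [set y | way_below y x] := (contL.2 x).1.
Let sup_below x : supremums [set y | way_below y x] x := (contL.2 x).2.

Lemma way_below_le x y : way_below x y -> (x <= y)%O.
Proof. exact: (sup_below y).1. Qed.

Lemma le_way_below x y z : (x <= y)%O -> way_below y z -> way_below x z.
Proof.
move=> xy yz D s dD sD zs; have [e De ye] := yz D s dD sD zs.
by exists e => //; exact: le_trans xy ye.
Qed.

Lemma way_below_le_trans x y z : way_below x y -> (y <= z)%O -> way_below x z.
Proof. by move=> xy yz D s dD sD zs; apply: xy dD sD _; exact: le_trans yz zs. Qed.

(** The approximants of approximants of [y] form a directed set with supremum [y], to which
    [way_below x y] applies. *)
Lemma way_below_interp x y :
  way_below x y -> exists2 w, way_below x w & way_below w y.
Proof.
move=> xy; pose D := [set z | exists2 w, way_below z w & way_below w y].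
have dD : order_directed D.
  split=> [|z1 z2 [w1 zw1 wy1] [w2 zw2 wy2]].
    have [w wy] := (dir_below y).1; have [z zw] := (dir_below w).1.
    by exists z, w.
  have [w [wy w1w w2w]] := (dir_below y).2 _ _ wy1 wy2.
  have [z [zw z1z z2z]] := (dir_below w).2 _ _
    (way_below_le_trans zw1 w1w) (way_below_le_trans zw2 w2w).
  by exists z; split=> //; exists w.
have sD : supremums D y.
  split=> [z [w zw wy]|u Du].
    exact: le_trans (way_below_le zw) (way_below_le wy).
  apply: (sup_below y).2 => w wy; apply: (sup_below w).2 => z zw.
  by apply: Du; exists w.
have [z [w zw wy] xz] := xy D y dD sD (lexx y).
by exists w => //; exact: le_way_below zw.
Qed.

Lemma way_above_open x : scott_open [set y | way_below x y].
Proof.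
split=> [y z xy yz|D s dD sD xs]; first exact: way_below_le_trans xy yz.
have [w xw ws] := way_below_interp xs.
have [e De we] := ws D s dD sD (lexx s).
by exists e; split=> //; exact: way_below_le_trans xw we.
Qed.

(** The open sets of points way above some [x] in [U] cover [K]; the finitely many [x] of a subcover
    generate [W]. *)
Lemma FK_int_interp K U : K !=set0 -> compact K -> scott_open U -> K `<=` U ->
  exists2 W, FK_int K W & (W : set L) `<=` U.
Proof.
move=> [k Kk] /compact_coverP Kco oU KU.
have [||D' D'U KD'] := Kco (ex_intro _ k Kk) L U (fun x => [set y | way_below x y]).
- by move=> x _; exact: way_above_open.
- move=> x Kx; have [z [zx Uz]] := oU.2 _ _ (dir_below x) (sup_below x) (KU _ Kx).
  by exists z.
have [g D'g _] := KD' _ Kk.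
have finW : exists F : set L,
    [/\ finite_set F, F !=set0 & up_closure [set` D'] = up_closure F].
  by exists [set` D']; split=> //; exists g.
exists (FinUpset finW) => /=.
  exists (\bigcup_(x in [set` D']) [set y | way_below x y]); last first.
    by split=> // y [x D'x xy]; exists x => //; exact: way_below_le xy.
  split=> [x y [z D'z zx] xy|D s dD sD [z D'z zs]].
    by exists z => //; exact: way_below_le_trans zx xy.
  have [e [De ze]] := (way_above_open z).2 _ _ dD sD zs.
  by exists e; split=> //; exists z.
by move=> y [x D'x xy]; apply: oU.1 xy; exact/set_mem/D'U.
Qed.

Lemma FK_int_directed K : Qsets L K -> directed leU (FK_int K).
Proof.
move=> [K0 Kco _]; split.
  have [//|W KW _] := FK_int_interp K0 Kco (@scott_openT _ L).
  by exists W.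
move=> V1 V2 [U1 oU1 [KU1 UV1]] [U2 oU2 [KU2 UV2]].
have [|W KW WU] := FK_int_interp K0 Kco (scott_openI oU1 oU2).
  by move=> x Kx; split; [exact: KU1|exact: KU2].
by exists W; split=> // x /WU[]; [move=> /UV1|move=> _ /UV2].
Qed.

Lemma bigcap_FK_int K : Qsets L K -> \bigcap_(W in FK_int K) (W : set L) `<=` K.
Proof.
move=> [K0 Kco Ksat] x Kx; rewrite Ksat => U [oU KU].
by have [W KW] := FK_int_interp K0 Kco oU KU; apply; exact: Kx.
Qed.

(** [K2] lies in every member of [FK_int K1], and these intersect in [K1]. *)
Lemma FK_subset K1 K2 : Qsets L K1 -> FK K1 `<=` FK K2 -> K2 `<=` K1.
Proof.
move=> QK1 K12 x K2x; apply: bigcap_FK_int => // W [U oU [KU UW]].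
by apply: (K12 W) => //; exact: subset_trans KU UW.
Qed.

Lemma FK_Gamma K : Qsets L K -> Gamma (fin_upset L) (FK K).
Proof.
move=> QK; split; first exact: FK_closed.
have [[W [U oU [KU UW]]] _] := FK_int_directed QK.
by exists W; exact: subset_trans KU UW.
Qed.

Lemma cvgU_FK_int V : cvgU (FK_int (V : set L)) V.
Proof.
have [F [finF F0 VF]] := fin_upsetP V.
exists F; split=> //; move: finF => /finite_seqP[s Fs].
(* Each generator is the limit of its approximants. For any choice of approximants [e i], the upper
   set they generate is itself the required member of [FK_int V]. *)
pose t := in_tuple s; exists (size s), (fun i => [set y | way_below y (tnth t i)]).
have limt i : scott_lim [set y | way_below y (tnth t i)] (tnth t i).
  exact/(scott_lim_le_sup _ (dir_below _) (sup_below _)).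
split=> [i|i|x|e eD]; first exact: dir_below.
- by exists (tnth t i); split=> //; rewrite Fs /= mem_tnth.
- by rewrite Fs => /(tnthP t)[i ->]; exists i.
have finW : exists G : set L,
    [/\ finite_set G, G !=set0 & \bigcup_i up_closure [set e i] = up_closure G].
  exists (range e); split.
  - exact: finite_image.
  - move: F0 => [x]; rewrite Fs => /(tnthP t)[i _].
    by exists (e i); exists i.
  - apply/seteqP; split=> [y [i _ [_ -> ey]]|y [_ [i _ <-] ey]].
      by exists (e i) => //; exists i.
    by exists i => //; exists (e i).
exists (FinUpset finW) => //=.
exists (\bigcup_i [set y | way_below (e i) y]).
  by apply: scott_open_bigU => i; exact: way_above_open.
split=> [x|x [i _ ex]]; last by exists i => //; exists (e i) => //; exact: way_below_le.
rewrite VF => -[y]; rewrite Fs => /(tnthP t)[i ->] yx.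
by exists i => //; apply: way_below_le_trans yx; exact: eD.
Qed.

Lemma closed_FK_int (CC : set (fin_upset L)) V :
  closed CC -> FK_int (V : set L) `<=` CC -> CC V.
Proof.
move=> cC VC; apply: closed_cvgU cC _ VC (cvgU_FK_int V).
exact: FK_int_directed (fin_upset_Qsets V).
Qed.

(** Rudin's lemma is applied to the union of the families [FK_int K], directed because [FK_int] is
    antitone. *)
Lemma scott_well_filtered (KK : set (set (scott L))) U :
  KK `<=` Qsets L -> directed (fun K1 K2 => K2 `<=` K1) KK -> scott_open U ->
  \bigcap_(K in KK) K `<=` U -> exists2 K, KK K & K `<=` U.
Proof.
move=> KKQ [[K0 KK0] dKK] oU KKU.
have [||W [K KKK [O oO [KO OW]]] WU] :=
    @rudin _ _ (\bigcup_(K in KK) FK_int K) U dcL _ oU.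
- split=> [|V1 V2 [K1 KK1 KV1] [K2 KK2 KV2]].
    have [[W KW] _] := FK_int_directed (KKQ _ KK0).
    by exists W, K0.
  have [K [KKK K1K K2K]] := dKK _ _ KK1 KK2.
  have [W [KW le1 le2]] :=
    (FK_int_directed (KKQ _ KKK)).2 _ _ (FK_int_sub K1K KV1) (FK_int_sub K2K KV2).
  by exists W; split=> //; exists K.
- move=> x Wx; apply: KKU => K KKK; apply: (bigcap_FK_int (KKQ _ KKK)) => W KW.
  by apply: Wx; exists K.
- by exists K => // x /KO/OW/WU.
Qed.

(** Well-filteredness for the empty open set gives a point; for the union of an open cover it gives
    one [K] whose finite subcover also covers the intersection. *)
Lemma Qsets_bigcap (KK : set (set (scott L))) :
  KK `<=` Qsets L -> directed (fun K1 K2 => K2 `<=` K1) KK ->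
  Qsets L (\bigcap_(K in KK) K).
Proof.
move=> KKQ dKK.
have KK0 : \bigcap_(K in KK) K !=set0.
  apply: contrapT => KK0.
  have [|x Kx|K KKK K0] := @scott_well_filtered KK set0 KKQ dKK.
  - by split=> // D s _ _ [].
  - by apply: KK0; exists x.
  - by have [[x /K0]] := KKQ _ KKK.
split=> //.
- apply/compact_coverP => // I D f fo KKf.
  have [|//|K KKK Kf] := @scott_well_filtered KK (cover D f) KKQ dKK.
    exact: (@bigcup_open (scott L) I D f fo).
  have [K0 /compact_coverP Kco _] := KKQ _ KKK.
  have [D' D'D KD'] := Kco K0 I D f fo Kf.
  by exists D' => // x /(_ _ KKK)/KD'.
- apply/saturated_scottP => x y Kx xy K KKK.
  have [_ _ /saturated_scottP Kup] := KKQ _ KKK.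
  by apply: Kup xy; exact: Kx.
Qed.

Lemma FK_Gamma_sup_closed : Gamma_sup_closed [set FK K | K in Qsets L].
Proof.
split=> [_ [K QK <-]|DD A DDQ [[B0 DB0] dDD] [[cA _] DDA Amin]]; first exact: FK_Gamma.
pose KK := [set K | Qsets L K /\ DD (FK K)].
have KKQ : KK `<=` Qsets L by move=> K [].
have dKK : directed (fun K1 K2 => K2 `<=` K1) KK.
  split=> [|K1 K2 [QK1 D1] [QK2 D2]].
    by have [K QK KB0] := DDQ _ DB0; exists K; split=> //; rewrite KB0.
  have [B [DB le1 le2]] := dDD _ _ D1 D2.
  have [K QK KB] := DDQ _ DB; rewrite -KB in DB le1 le2.
  by exists K; split=> //; exact: FK_subset.
exists (\bigcap_(K in KK) K); first exact: Qsets_bigcap.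
apply/seteqP; split=> [V KV|]; last first.
  apply: Amin; first exact/FK_Gamma/Qsets_bigcap.
  move=> B DB; have [K QK KB] := DDQ _ DB; rewrite -KB in DB *.
  by move=> V KV x Kx; apply: KV; exact: Kx.
(* [U] contains the intersection, hence some [K] by well-filteredness, so [W] lies in [FK K] and
   thus in [A]. *)
apply: closed_FK_int cA _ => W [U oU [VU UW]].
have [|K [QK DK] KU] := scott_well_filtered KKQ dKK oU.
  exact: subset_trans KV VU.
by apply: (DDA _ DK); exact: subset_trans KU UW.
Qed.

Lemma FK_Gamma_sup K : Qsets L K ->
  Gamma_sup [set principal_lower V | V in FK_int K] (FK K).
Proof.
move=> QK; split=> [|_ [V [U oU [KU UV]] <-]|C [cC _] DC V KV].
- exact: FK_Gamma.
- rewrite principal_lowerE // => W VW.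
  exact: subset_trans KU (subset_trans UV VW).
(* Since [V] contains [K], every member of [FK_int V] is in [FK_int K], hence in [C]. *)
apply: closed_FK_int cC _ => W /(FK_int_sub KV) KW.
by apply: (DC (principal_lower W)); [exists W|rewrite principal_lowerE].
Qed.

Lemma tildeE : tilde (fin_upset L) = [set FK K | K in Qsets L].
Proof.
apply/seteqP; split.
  apply: smallest_sub; first exact: FK_Gamma_sup_closed.
  move=> _ [V _ <-]; exists (V : set L); first exact: fin_upset_Qsets.
  by rewrite principal_lowerE.
move=> _ [K QK <-] S [[_ Ssup] rS].
apply: Ssup (FK_Gamma_sup QK); first by move=> _ [V _ <-]; apply: rS; exists V.
have [[W KW] dK] := FK_int_directed QK.
split=> [|_ _ [V1 KV1 <-] [V2 KV2 <-]]; first by exists (principal_lower W), W.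
have [V [KV le1 le2]] := dK _ _ KV1 KV2.
exists (principal_lower V); rewrite !principal_lowerE //; split.
- by exists V => //; rewrite principal_lowerE.
- by move=> V' VV'; exact: subset_trans le1 VV'.
- by move=> V' VV'; exact: subset_trans le2 VV'.
Qed.

End ContinuousDcpo.

Theorem theorem5p11 (d : Order.disp_t) (L : porderType d)
    (contL : continuous_dcpo L) :
  tilde (fin_upset L) = [set FK K | K in Qsets L] /\
  (set_bij (Qsets L) (tilde (fin_upset L)) FK /\
   forall K1 K2 : set (scott L), Qsets L K1 -> Qsets L K2 ->
     (K2 `<=` K1 <-> FK K1 `<=` FK K2)).
Proof.
split; first exact: tildeE.
split; last first.
  move=> K1 K2 QK1 _; split=> [K21 V|]; last exact: FK_subset.
  exact: subset_trans K21.
rewrite tildeE //; split=> [K QK|K1 K2 /set_mem QK1 /set_mem QK2 E|//].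
  by exists K.
by apply/seteqP; split; apply: FK_subset => //; rewrite E.
Qed.
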